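(* Let $(X,\le)=H_q(m,n)$ be a Hamming semilattice (the case $q=1$) or a $q$-Hamming semilattice ($q$ a prime power), and let $\Omega$ be its top level. Let $t\in\{0,\ldots,n\}$ and let $\beta:\Omega\to\mathbb{C}$ be a $t$-design of index $\lambda$. Let $a\in X$. Then the following systems of equations hold, and they are equivalent. (a) (Mendelsohn equations) For all $r\in\{0,\ldots,t\}$, $$\sum_{s=r}^n\genfrac{[}{]}{0pt}{}{s}{r}_q\alpha_s(a)=\genfrac{[}{]}{0pt}{}{h(a)}{r}_q(\#M)^{t-r}\lambda.$$ The right-hand side admits the alternative expression $$\genfrac{[}{]}{0pt}{}{h(a)}{r}_q(\#M)^{t-r}\lambda=\genfrac{[}{]}{0pt}{}{h(a)}{r}_q(\#M)^{-r}\,\#\beta.$$ (b) (K\''ohler parametrization) For all $r\in\{0,\ldots,t\}$, $$\alpha_r(a)=\genfrac{[}{]}{0pt}{}{h(a)}{r}_q(\#M)^{t-r}\lambda\sum_{j=0}^{t-r}(-1)^jq^{\binom{j}{2}}\genfrac{[}{]}{0pt}{}{h(a)-r}{j}_q(\#M)^{-j}-\sum_{u=t+1}^n\genfrac{[}{]}{0pt}{}{u}{r}_q\Big(\sum_{j=0}^{t-r}(-1)^jq^{\binom{j}{2}}\genfrac{[}{]}{0pt}{}{u-r}{j}_q\Big)\alpha_u(a).$$ The inner sum on the right-hand side admits the alternative form $$\sum_{j=0}^{t-r}(-1)^jq^{\binom{j}{2}}\genfrac{[}{]}{0pt}{}{u-r}{j}_q=-\sum_{j=t-r+1}^{u-r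}(-1)^jq^{\binom{j}{2}}\genfrac{[}{]}{0pt}{}{u-r}{j}_q.$$
   Context: Hamming semilattice $H(m,n)=H_1(m,n)$: let $N$ and $M$ be finite sets of sizes $n$ and $m\ge 1$. $X$ is the set of all partial maps from $N$ to $M$, i.e. all maps $f:W_f\to M$ with $W_f\subseteq N$, ordered by $f\le g$ if and only if $W_f\subseteq W_g$ and $g|_{W_f}=f$. The height is $h(f)=\#W_f$. $q$-Hamming semilattice $H_q(m,n)$, $q$ a prime power: let $N$ and $M$ be $\mathbb{F}_q$-vector spaces of finite dimensions $n$ and $m$. $X$ is the set of all partial linear maps, i.e. all linear maps $f:W_f\to M$ with $W_f$ a subspace of $N$, with the same order. The height is $h(f)=\dim W_f$. In both cases $(X,\le)$ is a $\wedge$-semilattice of height $n$; the meet $f\wedge g$ has domain $\{x\in W_f\cap W_g: f(x)=g(x)\}$ and is the common restriction of $f$ and $g$ to it. The levels are $X_r=\{x\in X: h(x)=r\}$, and the top level $\Omega=X_n$ consists of all (linear) maps $N\to M$. Thus $\#M=m$ in the Hamming case and $\#M=q^m$ in the $q$-Hamming case. $\genfrac{[}{]}{0pt}{}{a}{b}_q$ is the Gaussian binomial coefficient, which for $q=1$ is the ordinary binomial coefficient $\binom{a}{b}$; it is $0$ for $b>a\ge 0$. (When $h(a)<r$, the factor $\genfrac{[}{]}{0pt}{}{h(a)}{r}_q$ is zero and the term containing $\genfrac{[}{]}{0pt}{}{h(a)-r}{j}_q$ is read as zero.) For $\beta:\Omega\to\mathbb{C}$ put $\#\beta=\sum_{x\in\Omega}\beta(x)$.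 $\beta$ is a $t$-design of index $\lambda$ if $\sum_{x\in\Omega,\,b\le x}\beta(x)=\lambda$ for all $b\in X_t$. For $r\in\{0,\ldots,n\}$ the intersection numbers of $\beta$ with respect to $a\in X$ are $\alpha_r(a)=\sum_{y\in\Omega,\,h(y\wedge a)=r}\beta(y)$. *)

(* Defs.v *)
From HB Require Import structures.
From mathcomp Require Export all_boot all_order all_algebra all_field.
From mathcomp Require Export reals complex.

Set Implicit Arguments.
Unset Strict Implicit.
Unset Printing Implicit Defensive.

Import Order.TTheory GRing.Theory.
Local Open Scope ring_scope.

Fact hamming_display : Order.disp_t. Proof. exact: Order.Disp tt tt. Qed.

(* A partial map f : W_f -> M with W_f a subset of N; [f x = None] encodes
   that x lies outside W_f. *)
Definition partial_map (N M : finType) : predArgType := {ffun N -> option M}.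

Section PartialMap.
Variables N M : finType.
Implicit Types f g : partial_map N M.

HB.instance Definition _ := Finite.on (partial_map N M).

Definition pmap_dom f : {set N} := [set x | isSome (f x)].

Definition pmap_le f g : bool :=
  (pmap_dom f \subset pmap_dom g) && [forall x in pmap_dom f, g x == f x].

(* The domain is {x in W_f :&: W_g | f x = g x}: if neither f nor g is defined
   at x, then neither is the meet. *)
Definition pmap_meet f g : partial_map N M :=
  [ffun x => if f x == g x then f x else None].

Lemma pmap_leP f g :
  reflect (forall x, isSome (f x) -> g x = f x) (pmap_le f g).
Proof.
apply: (iffP andP) => [[_ /forall_inP H] x fx | H].
  by apply/eqP/H; rewrite inE.
split; first by apply/subsetP => x; rewrite !inE => fx; rewrite H.
by apply/forall_inP => x; rewrite inE => /H ->.
Qed.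

Fact pmap_le_refl : reflexive pmap_le.
Proof. by move=> f; apply/pmap_leP. Qed.

Fact pmap_le_anti : antisymmetric pmap_le.
Proof.
move=> f g /andP[/pmap_leP fg /pmap_leP gf]; apply/ffunP => x.
case Ef: (f x) => [u|]; first by rewrite fg Ef.
by case Eg: (g x) => [v|//]; rewrite -Ef gf Eg.
Qed.

Fact pmap_le_trans : transitive pmap_le.
Proof.
move=> g f h /pmap_leP fg /pmap_leP gh; apply/pmap_leP => x fx.
by rewrite gh fg.
Qed.

HB.instance Definition _ := Order.Le_isPOrder.Build hamming_display
  (partial_map N M) pmap_le_refl pmap_le_anti pmap_le_trans.

Fact pmap_lexI f g h :
  pmap_le f (pmap_meet g h) = pmap_le f g && pmap_le f h.
Proof.
apply/pmap_leP/andP => [H | [/pmap_leP fg /pmap_leP fh] x fx].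
  split; apply/pmap_leP => x fx; have := H x fx; rewrite ffunE.
    by case: eqP => // _ fE; rewrite -fE in fx.
  by case: eqP => [-> //|_ fE]; rewrite -fE in fx.
by rewrite ffunE fg // fh // eqxx.
Qed.

HB.instance Definition _ := Order.POrder_isMeetSemilattice.Build
  hamming_display (partial_map N M) pmap_lexI.

End PartialMap.

(* [finvect_type V] is V itself, seen as a finite type when the scalars are
   finite. *)
Section PartialLinearMap.
Variables (F : finFieldType) (N M : vectType F).
Implicit Types f g : partial_map (finvect_type N) (finvect_type M).

(* W_f is a subspace (contains 0, stable under linear combinations) and f is
   linear on W_f. *)
Definition is_plinear f : bool :=
  isSome (f 0) &&
  [forall a : F, forall x in pmap_dom f, forall y in pmap_dom f,
    f (a *: x + y) ==
      (if (f x, f y) is (Some u, Some v) then Some (a *: u + v) else None)].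

Lemma is_plinearP f :
  reflect (isSome (f 0) /\ forall (a : F) x y u v,
             f x = Some u -> f y = Some v -> f (a *: x + y) = Some (a *: u + v))
          (is_plinear f).
Proof.
apply: (iffP andP) => [[f0 H] | [f0 H]]; split=> //.
  move=> a x y u v fx fy; move/forallP/(_ a)/forall_inP/(_ x): H.
  rewrite inE fx => /(_ isT)/forall_inP/(_ y); rewrite inE fy.
  by move=> /(_ isT)/eqP.
apply/forallP => a; apply/forall_inP => x; rewrite inE.
case fx: (f x) => [u|//] _; apply/forall_inP => y; rewrite inE.
by case fy: (f y) => [v|//] _; rewrite (H a x y u v).
Qed.

Record partial_linear_map : predArgType := PLinear {
  plin_val :> partial_map (finvect_type N) (finvect_type M);
  _ : is_plinear plin_val }.

HB.instance Definition _ := [isSub for plin_val].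
HB.instance Definition _ := [Finite of partial_linear_map by <:].

Implicit Types p q : partial_linear_map.

(* The span of the underlying set of W_f, which is W_f itself (mem_plin_dom). *)
Definition plin_dom p : {vspace finvect_type N} := <<enum (pmap_dom p)>>%VS.

Lemma mem_plin_dom p (x : finvect_type N) :
  (x \in plin_dom p) = (x \in pmap_dom p).
Proof.
case: p => p pL; have /is_plinearP[p0 H] := pL; rewrite /plin_dom /=.
apply/idP/idP => [|xp]; last by apply: memv_span; rewrite mem_enum.
have p00 : p 0 = Some 0.
  case E: (p 0) p0 => [u|//] _; have := H (-1) _ _ _ _ E E.
  by rewrite !scaleN1r !addNr E.
have sumP (I : Type) (r : seq I) (c : I -> F) (y : I -> finvect_type N) :
    (forall i, y i \in pmap_dom p) -> \sum_(i <- r) c i *: y i \in pmap_dom p.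
  move=> yp; elim: r => [|i r IH]; first by rewrite big_nil inE p00.
  rewrite big_cons; move: IH (yp i); rewrite !inE.
  case Es: (p (\sum_(j <- r) _)) => [v|//] _; case Ey: (p (y i)) => [u|//] _.
  by rewrite (H _ _ _ _ _ Ey Es).
move/coord_span=> ->; apply: sumP => i.
rewrite -mem_enum; apply: (@mem_nth (finvect_type N)).
by rewrite -cardE ltn_ord.
Qed.

Definition plin_le p q : bool := pmap_le p q.

Fact plin_le_refl : reflexive plin_le.
Proof. by move=> p; apply: pmap_le_refl. Qed.

Fact plin_le_anti : antisymmetric plin_le.
Proof. by move=> p q /pmap_le_anti/val_inj. Qed.

Fact plin_le_trans : transitive plin_le.
Proof. by move=> q p r; apply: pmap_le_trans. Qed.

HB.instance Definition _ := Order.Le_isPOrder.Build hamming_display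
  partial_linear_map plin_le_refl plin_le_anti plin_le_trans.

Fact plin_meet_subproof p q : is_plinear (pmap_meet p q).
Proof.
case: p q => [p pL] [q qL] /=.
have /is_plinearP[p0 Hp] := pL; have /is_plinearP[q0 Hq] := qL.
have z0 (f : partial_map (finvect_type N) (finvect_type M)) :
    is_plinear f -> f 0 = Some 0.
  case/is_plinearP; case E: (f 0) => [u|//] _ /(_ (-1) _ _ _ _ E E).
  by rewrite !scaleN1r !addNr E.
apply/is_plinearP; split=> [|a x y u v]; first by rewrite ffunE !z0 ?eqxx.
rewrite !ffunE; case: eqP => // pqx pu; case: eqP => // pqy pv.
have qu : q x = Some u by rewrite -pqx.
have qv : q y = Some v by rewrite -pqy.
by rewrite (Hp a _ _ _ _ pu pv) (Hq a _ _ _ _ qu qv) eqxx.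
Qed.

Definition plin_meet p q : partial_linear_map :=
  PLinear (plin_meet_subproof p q).

Fact plin_lexI p q r : plin_le p (plin_meet q r) = plin_le p q && plin_le p r.
Proof. exact: pmap_lexI. Qed.

HB.instance Definition _ := Order.POrder_isMeetSemilattice.Build
  hamming_display partial_linear_map plin_lexI.

End PartialLinearMap.

(* The data defining H_1(m,n) (two finite sets, the second nonempty) or
   H_q(m,n) (two finite-dimensional spaces over the field with q elements). *)
Inductive hamming_data : Type :=
  | Hamming (N M : finType) of (0 < #|M|)%N
  | QHamming (F : finFieldType) (N M : vectType F).

Definition hq (H : hamming_data) : nat :=
  match H with
  | Hamming _ _ _ => 1
  | QHamming F _ _ => #|F|
  end.

Definition hn (H : hamming_data) : nat :=
  match H with
  | Hamming N _ _ => #|N|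
  | QHamming _ N _ => \dim {:N}
  end.

Definition hcardM (H : hamming_data) : nat :=
  match H with
  | Hamming _ M _ => #|M|
  | QHamming _ _ M => #|finvect_type M|
  end.

Definition hsemilattice (H : hamming_data) :
    finMeetSemilatticeType hamming_display :=
  match H with
  | Hamming N M _ => partial_map N M
  | QHamming _ N M => partial_linear_map N M
  end.

Definition height (H : hamming_data) : hsemilattice H -> nat :=
  match H with
  | Hamming _ _ _ => fun f => #|pmap_dom f|
  | QHamming _ _ _ => fun f => \dim (plin_dom f)
  end.

Definition Omega (H : hamming_data) : finType :=
  {x : hsemilattice H | height x == hn H}.

(* For b > a the factor with i = a vanishes, since then q ^ (a - i) = 1. *)
Definition gbinom (K : fieldType) (q a b : nat) : K :=
  if q == 1%N then 'C(a, b)%:R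
  else \prod_(i < b) ((q%:R ^+ (a - i) - 1) / (q%:R ^+ i.+1 - 1)).

Section Designs.
Variables (K : fieldType) (H : hamming_data).
Local Notation X := (hsemilattice H).
Local Notation q := (hq H).
Local Notation n := (hn H).
Local Notation "#M" := ((hcardM H)%:R : K) (at level 0).
Local Notation "[[ a , b ]]" := (gbinom K q a b) (at level 0).

Definition is_design (t : nat) (lambda : K) (beta : Omega H -> K) : Prop :=
  forall b : X, height b = t ->
    \sum_(x : Omega H | (b <= val x)%O) beta x = lambda.

Definition total (beta : Omega H -> K) : K := \sum_(x : Omega H) beta x.

Definition intersection_number (beta : Omega H -> K) (a : X) (r : nat) : K :=
  \sum_(y : Omega H | height (val y `&` a)%O == r) beta y.

(* The next two systems are stated for an arbitrary vector alpha of unknowns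
   (alpha 0, ..., alpha n), so that they can be compared as linear systems. *)
Definition mendelsohn_equations (t : nat) (lambda : K) (a : X)
    (alpha : nat -> K) : Prop :=
  forall r, (r <= t)%N ->
    \sum_(r <= s < n.+1) [[s, r]] * alpha s =
      [[height a, r]] * #M ^+ (t - r) * lambda.

(* If height a < r, then [[height a, r]] = 0 and the truncated subtraction in
   height a - r is irrelevant. *)
Definition kohler_equations (t : nat) (lambda : K) (a : X)
    (alpha : nat -> K) : Prop :=
  forall r, (r <= t)%N ->
    alpha r =
      [[height a, r]] * #M ^+ (t - r) * lambda *
        (\sum_(0 <= j < (t - r).+1)
           (-1) ^+ j * q%:R ^+ 'C(j, 2) * [[height a - r, j]] * #M ^- j)
      - \sum_(t.+1 <= u < n.+1)
          [[u, r]] *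
          (\sum_(0 <= j < (t - r).+1)
             (-1) ^+ j * q%:R ^+ 'C(j, 2) * [[u - r, j]]) * alpha u.

End Designs.

(* Main.v *)
From mathcomp Require Import zify ring.
Require Import Defs.

Set Implicit Arguments.
Unset Strict Implicit.
Unset Printing Implicit Defensive.

Import Order.TTheory GRing.Theory Num.Theory.
Local Open Scope ring_scope.

(** Two facts about the semilattice drive the proof.

    - Below an element [a] there are exactly [[h(a), r]] elements of height
      [r] ([gbinom_card_below]): an element below [a] is the restriction of [a]
      to a subset, or subspace, of its domain.
    - If [c] is not of full height, then the top elements above [c] are split
      according to their value at one fixed point outside the domain of [c], and
      each of the #M classes is the set of all top elements above an extension
      of [c] of height h(c) + 1 ([extension_partition]).

    The second fact and a downward induction on the height show that a
    [t]-design sums to #M ^ (t - h(c)) lambda over the top elements above any [c]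
    with h(c) <= t ([design_below]).  The Mendelsohn equations then come from
    counting, with weight [beta y], the pairs (c, y) where [c] has height [r]
    and lies below both [a] and the top element [y].  Summing over [y] first
    gives the right-hand side; summing over [c] first counts the elements of
    height [r] below the meet of [y] and [a], which gives the left-hand side.
    For r = 0 the equation reads #beta = #M ^ t lambda, whence the alternative
    right-hand side.

    The Koehler parametrization is the Mendelsohn system solved for
    alpha_0, ..., alpha_t, the terms with u > t being moved to the right.  The
    matrix of the square system so obtained is the triangular matrix of Gaussian
    binomials, whose inverse has the entries
    (-1) ^ (s - r) q ^ C(s - r, 2) [[s, r]] ([gauss_inversion]).  This rests on
    the vanishing of the full alternating sum of a row [[m, j]], m > 0
    ([sum_qsign_gbinom_eq0]), which is also the alternative form of the inner
    sum.  No step divides into the cases q = 1 and q > 1 once the factorial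
    formula [gbinom_fact] and the two facts above are available. *)

(** * Sums over intervals *)

Lemma big_nat_shift (V : nmodType) (F : nat -> V) r t : (r <= t)%N ->
  \sum_(r <= s < t.+1) F s = \sum_(0 <= j < (t - r).+1) F (r + j)%N.
Proof.
move=> lert; rewrite -{1}[r]add0n big_addn -subSn //.
by apply: eq_bigr => j _; rewrite addnC.
Qed.

Lemma big_ord_from (V : nmodType) (F : nat -> V) r t : (r <= t)%N ->
  (forall s, (s < r)%N -> F s = 0) ->
  \sum_(s < t.+1) F s = \sum_(r <= s < t.+1) F s.
Proof.
move=> lert F0; rewrite -(big_mkord xpredT).
rewrite (big_cat_nat (n := r)) //=; last exact: leqW.
by rewrite big_nat big1 ?add0r // => s /F0.
Qed.

(** * Gaussian binomials and their inversion formula *)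

Section GaussianBinomials.
Variables (K : numFieldType) (q : nat).
Hypothesis q_gt0 : (0 < q)%N.

Definition qint (n : nat) : K := \sum_(i < n) q%:R ^+ i.

Definition qfact (n : nat) : K := \prod_(i < n) qint i.+1.

Lemma qint0 : qint 0 = 0. Proof. by rewrite /qint big_ord0. Qed.

Lemma qint_neq0 n : qint n.+1 != 0.
Proof.
rewrite /qint big_ord_recl expr0 gt_eqF // ltr_pwDl // sumr_ge0 // => i _.
by rewrite exprn_ge0 // ler0n.
Qed.

Lemma qfact_neq0 n : qfact n != 0.
Proof. by apply/prodf_neq0 => i _; apply: qint_neq0. Qed.

Lemma qfact0 : qfact 0 = 1. Proof. by rewrite /qfact big_ord0. Qed.

Lemma qfactS n : qfact n.+1 = qfact n * qint n.+1.
Proof. by rewrite /qfact big_ord_recr. Qed.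

Lemma qintD m n : qint (m + n) = qint m + q%:R ^+ m * qint n.
Proof.
rewrite /qint big_split_ord /= mulr_sumr; congr (_ + _).
by apply: eq_bigr => i _; rewrite exprD.
Qed.

Lemma gbinom0 a : gbinom K q a 0 = 1.
Proof. by rewrite /gbinom bin0 big_ord0; case: ifP. Qed.

(** The recursion in the lower index holds for q = 1 and for q > 1 alike because
    q ^ n - 1 = (q - 1) [n]_q; the rest of the theory is derived from it. *)
Lemma gbinomS a b : gbinom K q a b.+1 * qint b.+1 = gbinom K q a b * qint (a - b).
Proof.
rewrite /gbinom; case: eqP => [q1|/eqP q1].
  have qE n : qint n = n%:R.
    rewrite /qint q1 (eq_bigr (fun=> 1)) => [|i _]; last by rewrite expr1n.
    by rewrite sumr_const card_ord.
  by rewrite !qE -!natrM mulnC mul_bin_left mulnC.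
have q1K : q%:R - 1 != 0 :> K by rewrite subr_eq0 -[1]/(1%:R) eqr_nat.
rewrite big_ord_recr /= !subrX1 -/(qint _) -/(qint _) invfM mulrACA divff //.
by rewrite mul1r -!mulrA mulVf ?mulr1 // qint_neq0.
Qed.

Lemma gbinom_small a b : (a < b)%N -> gbinom K q a b = 0.
Proof.
elim: b => // b IH; rewrite ltnS => leab; apply: (mulIf (qint_neq0 b)).
rewrite gbinomS mul0r; move: leab; rewrite leq_eqVlt => /orP[/eqP->|/IH->].
  by rewrite subnn qint0 mulr0.
by rewrite mul0r.
Qed.

Lemma gbinom_fact a b : (b <= a)%N ->
  gbinom K q a b * (qfact b * qfact (a - b)) = qfact a.
Proof.
elim: b => [|b IH] leba; first by rewrite gbinom0 qfact0 subn0 !mul1r.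
rewrite -(IH (ltnW leba)) qfactS.
have -> : (a - b)%N = (a - b.+1).+1 by lia.
rewrite qfactS (_ : (a - b.+1).+1 = (a - b)%N); last by lia.
by have := gbinomS a b => E; ring: E.
Qed.

Lemma gbinomE a b : (b <= a)%N ->
  gbinom K q a b = qfact a / (qfact b * qfact (a - b)).
Proof. by move=> /gbinom_fact <-; rewrite mulfK // mulf_neq0 ?qfact_neq0. Qed.

Lemma gbinomn n : gbinom K q n n = 1.
Proof.
by rewrite gbinomE // subnn qfact0 mulr1 divff ?qfact_neq0.
Qed.

Lemma gbinom_pascal a b :
  gbinom K q a.+1 b.+1 = gbinom K q a b + q%:R ^+ b.+1 * gbinom K q a b.+1.
Proof.
case: (ltngtP b a) => [ltba|ltab|->].
- rewrite !gbinomE //; try lia.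
  have -> : (a - b)%N = (a - b.+1).+1 by lia.
  rewrite subSS !qfactS.
  have -> : (a - b)%N = (a - b.+1).+1 by lia.
  rewrite qfactS.
  have -> : a.+1 = (b.+1 + (a - b.+1).+1)%N by lia.
  rewrite qintD.
  move: (qfact_neq0 b) (qfact_neq0 (a - b.+1)) (qint_neq0 b) (qint_neq0 (a - b.+1)).
  move: (qfact a) (qfact b) (qfact _) (qint b.+1) (qint _) (_ ^+ _) => x y z u v w.
  by move=> *; field; apply/and4P; split.
- by rewrite !gbinom_small ?mulr0 ?addr0 // ltnW.
- by rewrite !gbinomn gbinom_small // mulr0 addr0.
Qed.

(** Both sides are the q-multinomial coefficient of u with parts r, s - r and
    u - s if s <= u, and vanish otherwise. *)
Lemma gbinom_trinomial u s r : (r <= s)%N ->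
  gbinom K q u s * gbinom K q s r = gbinom K q u r * gbinom K q (u - r) (s - r).
Proof.
move=> lers; case: (leqP s u) => lesu; last first.
  rewrite gbinom_small // mul0r; case: (leqP r u) => leru.
    by rewrite [X in _ * X]gbinom_small ?mulr0 //; lia.
  by rewrite gbinom_small // mul0r.
rewrite !gbinomE //; try lia.
have -> : (u - r - (s - r))%N = (u - s)%N by lia.
by field; rewrite !qfact_neq0.
Qed.

Definition qsign (j : nat) : K := (-1) ^+ j * q%:R ^+ 'C(j, 2).

(** By Pascal's rule the [j]-th term is a difference for j > 0: with
    c_j = (-1) ^ j q ^ C(j + 1, 2) [[m, j]] it equals c_j - c_(j - 1), because
    C(j, 2) + j = C(j + 1, 2).  So the partial sums telescope. *)
Lemma sum_qsign_gbinom m k :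
  \sum_(0 <= j < k.+1) qsign j * gbinom K q m.+1 j =
  (-1) ^+ k * q%:R ^+ 'C(k.+1, 2) * gbinom K q m k.
Proof.
elim: k => [|k IH]; first by rewrite big_nat1 /qsign !gbinom0 bin0n.
rewrite big_nat_recr //= IH gbinom_pascal /qsign.
rewrite [in RHS]binS bin1 exprD exprS; ring.
Qed.

Lemma sum_qsign_gbinom_eq0 m k : (m <= k)%N ->
  \sum_(0 <= j < k.+1) qsign j * gbinom K q m j = (m == 0%N)%:R.
Proof.
case: m => [_|m ltmk]; last first.
  by rewrite sum_qsign_gbinom gbinom_small // mulr0.
rewrite big_nat_recl //= big1_seq => [|j _].
  by rewrite addr0 gbinom0 /qsign bin0n !expr0 !mulr1.
by rewrite gbinom_small // mulr0.
Qed.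

(** For q = 1 this is binomial inversion.  Only one of the two matrix products
    has to be computed: a one-sided inverse of a square matrix is two-sided. *)
Lemma gauss_inversion (x y : nat -> K) t :
  (forall r, (r <= t)%N -> \sum_(r <= s < t.+1) gbinom K q s r * x s = y r) <->
  (forall r, (r <= t)%N ->
     x r = \sum_(r <= s < t.+1) qsign (s - r) * gbinom K q s r * y s).
Proof.
pose A : 'M[K]_t.+1 := \matrix_(r, s) gbinom K q s r.
pose B : 'M[K]_t.+1 := \matrix_(r, s) (qsign (s - r) * gbinom K q s r).
pose X : 'cV[K]_t.+1 := \col_r x r; pose Y : 'cV[K]_t.+1 := \col_r y r.
have BA : B *m A = 1%:M.
  apply/matrixP => r u; rewrite !mxE.
  under eq_bigr do rewrite !mxE -mulrA [gbinom _ _ _ r * _]mulrC.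
  pose G s := qsign (s - r) * (gbinom K q u s * gbinom K q s r).
  rewrite (big_ord_from (F := G) (r := r)) //; last 2 first.
  - exact: leq_ord.
  - by move=> s ltsr; rewrite /G (gbinom_small ltsr) !mulr0.
  rewrite /G big_nat_shift ?leq_ord //.
  (* The entry (r, u) of the product is [[u, r]] times the full alternating sum
     of the row u - r. *)
  under eq_bigr do rewrite gbinom_trinomial ?leq_addr // addKn mulrCA.
  rewrite -mulr_sumr sum_qsign_gbinom_eq0; last by have := ltn_ord u; lia.
  case: (ltngtP r u) => [ltru|ltur|eqru].
  - by rewrite -(inj_eq val_inj) /= (ltn_eqF ltru) subn_eq0 leqNgt ltru mulr0.
  - by rewrite gbinom_small // mul0r -(inj_eq val_inj) /= gtn_eqF.
  - by rewrite -(inj_eq val_inj) /= eqru subnn !eqxx gbinomn mulr1.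
have AX r : (A *m X) r 0 = \sum_(r <= s < t.+1) gbinom K q s r * x s.
  rewrite mxE; under eq_bigr do rewrite !mxE.
  pose G s := gbinom K q s r * x s.
  rewrite (big_ord_from (F := G) (r := r)) ?leq_ord // => s ltsr.
  by rewrite /G gbinom_small ?mul0r.
have BY r : (B *m Y) r 0 = \sum_(r <= s < t.+1) qsign (s - r) * gbinom K q s r * y s.
  rewrite mxE; under eq_bigr do rewrite !mxE.
  pose G s := qsign (s - r) * gbinom K q s r * y s.
  rewrite (big_ord_from (F := G) (r := r)) ?leq_ord // => s ltsr.
  by rewrite /G gbinom_small ?mulr0 ?mul0r.
split=> H r; rewrite -ltnS => ltrt; pose i := Ordinal ltrt.
  have E : A *m X = Y by apply/colP => j; rewrite AX H ?mxE // -ltnS.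
  by rewrite -(BY i) -E mulmxA BA mul1mx mxE.
have E : X = B *m Y by apply/colP => j; rewrite BY mxE -H // -ltnS.
by rewrite -(AX i) E mulmxA (mulmx1C BA) mul1mx mxE.
Qed.

End GaussianBinomials.

(** * The number of linearly independent tuples *)

Section QFalling.
Variables (K : numFieldType) (q : nat).
Hypothesis q_gt1 : (1 < q)%N.

(** The number of linearly independent [r]-tuples in a space of dimension [k]
    over a field with [q] elements. *)
Definition qfalling (k r : nat) : K := \prod_(i < r) (q%:R ^+ k - q%:R ^+ i).

Lemma qfalling_small k r : (k < r)%N -> qfalling k r = 0.
Proof.
by move=> ltkr; rewrite /qfalling (bigD1 (Ordinal ltkr)) //= subrr mul0r.
Qed.

Lemma qfalling_neq0 r : qfalling r r != 0.
Proof.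
apply/prodf_neq0 => i _; rewrite subr_eq0 -!natrX eqr_nat eqn_exp2l //.
by rewrite gtn_eqF.
Qed.

(** For [k < r] the truncated subtractions are harmless, since both products
    contain a zero factor, the one with [i = k]. *)
Lemma natr_qfalling k r : (\prod_(i < r) (q ^ k - q ^ i))%:R = qfalling k r.
Proof.
case: (ltnP k r) => [ltkr|lerk].
  by rewrite qfalling_small // (bigD1 (Ordinal ltkr)) //= subnn mul0n.
rewrite natr_prod; apply: eq_bigr => i _; rewrite natrB ?natrX //.
by rewrite leq_exp2l // ltnW // (leq_trans (ltn_ord i)).
Qed.

Lemma qfallingE k r : (r <= k)%N -> qfalling k r =
  (\prod_(i < r) q%:R ^+ i) * \prod_(i < r) (q%:R ^+ (k - i) - 1).
Proof.
move=> lerk; rewrite -big_split /=; apply: eq_bigr => i _.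
by rewrite mulrBr mulr1 -exprD subnKC // ltnW // (leq_trans (ltn_ord i)).
Qed.

(** Factoring q ^ i out of q ^ k - q ^ i leaves the numerators of the Gaussian
    binomial, and for k = r its denominators in reverse order. *)
Lemma gbinom_qfalling k r : gbinom K q k r * qfalling r r = qfalling k r.
Proof.
case: (ltnP k r) => [ltkr|lerk].
  by rewrite gbinom_small ?(ltnW q_gt1) // mul0r qfalling_small.
have q1 : (q == 1)%N = false by rewrite gtn_eqF.
rewrite !qfallingE // /gbinom q1 prodf_div mulrCA; congr (_ * _).
have -> : \prod_(i < r) (q%:R ^+ (r - i) - 1) = \prod_(i < r) (q%:R ^+ i.+1 - 1) :> K.
  rewrite (reindex_inj rev_ord_inj); apply: eq_bigr => i _ /=.
  by rewrite subKn.
rewrite divfK //; apply/prodf_neq0 => i _.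
by rewrite subr_eq0 -natrX -[1]/(1%:R) eqr_nat -(expn0 q) eqn_exp2l.
Qed.

End QFalling.

(** * Partial maps between sets *)

Section Sets.
Variables N M : finType.
Implicit Types a c f : partial_map N M.

Definition pmap_restrict a (D : {set N}) : partial_map N M :=
  [ffun x => if x \in D then a x else None].

Lemma dom_restrict a (D : {set N}) :
  D \subset pmap_dom a -> pmap_dom (pmap_restrict a D) = D.
Proof.
move=> /subsetP sDa; apply/setP => x; rewrite inE ffunE.
by case: ifP => // /sDa; rewrite inE.
Qed.

Lemma restrict_le a D : pmap_le (pmap_restrict a D) a.
Proof. by apply/pmap_leP => x; rewrite ffunE; case: ifP. Qed.

Lemma le_restrictE c a : pmap_le c a -> c = pmap_restrict a (pmap_dom c).
Proof.
move=> /pmap_leP leca; apply/ffunP => x; rewrite ffunE inE.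
by case: ifP => [/leca->//|]; case: (c x).
Qed.

(** Restriction of [a] is a bijection from the [r]-subsets of its domain. *)
Lemma card_pmap_below a (r : nat) :
  #|[set c : partial_map N M | pmap_le c a & #|pmap_dom c| == r]|
    = 'C(#|pmap_dom a|, r).
Proof.
rewrite -cards_draws -(card_in_imset (f := pmap_restrict a)); last first.
  move=> D E; rewrite !inE => /andP[sD _] /andP[sE _] eqDE.
  by rewrite -(dom_restrict sD) eqDE dom_restrict.
apply: eq_card => c; rewrite inE; apply/andP/imsetP => [[leca dc]|[D]].
  exists (pmap_dom c); last exact: le_restrictE.
  by rewrite inE dc andbT; case/andP: leca.
by rewrite inE => /andP[sD dD] ->; rewrite restrict_le dom_restrict.
Qed.

Definition pmap_extend c (x : N) (v : M) : partial_map N M :=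
  [ffun z => if z == x then Some v else c z].

Lemma dom_extend c x v : pmap_dom (pmap_extend c x v) = x |: pmap_dom c.
Proof. by apply/setP => z; rewrite !inE ffunE; case: eqP. Qed.

Lemma extend_le c x v f : x \notin pmap_dom c ->
  pmap_le (pmap_extend c x v) f = pmap_le c f && (f x == Some v).
Proof.
rewrite inE => cx; apply/pmap_leP/andP => [H|[/pmap_leP H /eqP fx] z].
  split; last by have := H x; rewrite ffunE eqxx => ->.
  apply/pmap_leP => z cz; have := H z; rewrite ffunE.
  by case: eqP => [zx|_ ->//]; rewrite -zx cz in cx.
by rewrite ffunE; case: eqP => [->//|_]; apply: H.
Qed.
End Sets.

(** * Partial linear maps *)

Section Spaces.
Variables (F : finFieldType) (N M : vectType F).
Local Notation V := (finvect_type N).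
Local Notation W := (finvect_type M).
Implicit Types a c f : partial_linear_map N M.

(** A free tuple of length [i] in [U] can be prolonged by any vector of [U]
    outside its span, which has #F ^ i elements. *)
Lemma card_free_tuples (U : {vspace V}) (r : nat) :
  #|[set X : r.-tuple V | free X & all [in U] X]|
    = (\prod_(i < r) (#|F| ^ \dim U - #|F| ^ i))%N.
Proof.
elim: r => [|r IH].
  rewrite big_ord0 (eq_card (B := predT)) ?card_tuple ?expn0 // => X.
  by rewrite !inE tuple0 nil_free.
rewrite big_ord_recr /= -IH -[X in (X * _)%N]sum1_card big_distrl /= -sum1_card.
rewrite (partition_big (fun X : r.+1.-tuple V => [tuple of behead X])
  [in [set X : r.-tuple V | free X & all [in U] X]]) /=; last first.
  move=> X; case/tupleP: X => x X; rewrite !inE /= free_cons.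
  by case/andP=> /andP[_ ->] /andP[_ ->].
apply: eq_bigr => X; rewrite inE => /andP[fX sX].
rewrite mul1n sum1_card.
have sXU : (<<X>> <= U)%VS by apply/span_subvP => x /(allP sX).
pose D := [set x : V | (x \in U) && (x \notin <<X>>%VS)].
transitivity #|[set [tuple of x :: X] | x in D]|.
  apply: eq_card => Y; case/tupleP: Y => y Y.
  apply/andP/imsetP => [[]|[x]]; rewrite !inE /=.
    rewrite free_cons => /andP[/andP[yY fY] /andP[yU sY]] /eqP eqYX.
    have {}eqYX : Y = X by apply: val_inj; rewrite -eqYX.
    by exists y; rewrite ?inE -?eqYX ?yU.
  move=> /andP[xU xX] /(congr1 val)[-> eqYX].
  have {eqYX}-> : Y = X by apply: val_inj.
  by rewrite free_cons xX fX xU sX; split=> //; apply/eqP/val_inj.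
rewrite card_imset; last by move=> x y /(congr1 (@thead _ _)); rewrite !theadE.
have -> : D = [set x in U] :\: [set x in <<X>>%VS].
  by apply/setP => x; rewrite !inE andbC.
rewrite cardsDS; last by apply/subsetP => x; rewrite !inE => /(subvP sXU).
by rewrite !cardsE !card_vspace (eqP fX) size_tuple.
Qed.

Lemma plin0 c : plin_val c 0 = Some 0.
Proof.
case: c => f /= /is_plinearP[]; case E: (f 0) => [u|//] _ /(_ (-1) _ _ _ _ E E).
by rewrite !scaleN1r !addNr E.
Qed.

Lemma plinP c (k : F) x y u v : plin_val c x = Some u -> plin_val c y = Some v ->
  plin_val c (k *: x + y) = Some (k *: u + v).
Proof. by case: c => f /= /is_plinearP[_ H]; apply: H. Qed.

Lemma isSome_plin c (x : V) : isSome (plin_val c x) = (x \in plin_dom c).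
Proof. by rewrite mem_plin_dom inE. Qed.

Fact plin_restrict_subproof a (U : {vspace V}) :
  is_plinear (pmap_restrict (plin_val a) [set x in U]).
Proof.
apply/is_plinearP; split=> [|k x y u v]; first by rewrite ffunE inE mem0v plin0.
rewrite !ffunE !inE; case: ifP => // xU ax; case: ifP => // yU ay.
by rewrite memvD ?memvZ // (plinP k ax ay).
Qed.

Definition plin_restrict a U := PLinear (plin_restrict_subproof a U).

Lemma plin_dom_restrict a (U : {vspace V}) :
  (U <= plin_dom a)%VS -> plin_dom (plin_restrict a U) = U.
Proof.
move=> /subvP sUa; apply/vspaceP => x; rewrite mem_plin_dom /= dom_restrict ?inE //.
by apply/subsetP => y; rewrite inE => /sUa; rewrite mem_plin_dom.
Qed.

Lemma plin_restrict_le a U : plin_le (plin_restrict a U) a.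
Proof. exact: restrict_le. Qed.

Lemma plin_le_restrictE c a : plin_le c a -> c = plin_restrict a (plin_dom c).
Proof.
move=> leca; apply: val_inj; rewrite /= [LHS](le_restrictE leca); congr pmap_restrict.
by apply/setP => x; rewrite [RHS]inE mem_plin_dom.
Qed.

Lemma plin_le_dom c a : plin_le c a -> (plin_dom c <= plin_dom a)%VS.
Proof.
case/andP=> /subsetP sca _; apply/subvP => x; rewrite !mem_plin_dom; exact: sca.
Qed.

(** Sort the free [r]-tuples of the domain of [a] by the restriction of [a] to
    their span: the class of [c] consists of the bases of the domain of [c]. *)
Lemma card_plin_below a (r : nat) :
  (#|[set c : partial_linear_map N M | plin_le c a & \dim (plin_dom c) == r]|
    * \prod_(i < r) (#|F| ^ r - #|F| ^ i)
   = \prod_(i < r) (#|F| ^ \dim (plin_dom a) - #|F| ^ i))%N.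
Proof.
rewrite -card_free_tuples -sum1_card big_distrl /= -[RHS]sum1_card.
rewrite [RHS](partition_big (fun X : r.-tuple V => plin_restrict a <<X>>%VS)
  [in [set c : partial_linear_map N M | plin_le c a & \dim (plin_dom c) == r]]) /=.
  apply: eq_bigr => c; rewrite inE => /andP[leca /eqP dc].
  rewrite mul1n sum1_card; move: (card_free_tuples (plin_dom c) r); rewrite dc => <-.
  apply: eq_card => X; rewrite [RHS]unfold_in !inE.
  apply/andP/andP => [[fX /allP sX]|[/andP[fX sX]/eqP <-]].
    have sXc : (<<X>> <= plin_dom c)%VS by apply/span_subvP.
    have eXc : <<X>>%VS = plin_dom c.
      by apply/eqP; rewrite eqEdim sXc (eqP fX) size_tuple dc leqnn.
    rewrite eXc -plin_le_restrictE // eqxx; split=> //; apply/andP; split=> //.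
    by apply/allP => x /sX; apply/subvP/plin_le_dom.
  split=> //; rewrite plin_dom_restrict; last by apply/span_subvP => x /(allP sX).
  by apply/allP => x; apply: memv_span.
move=> X; rewrite !inE => /andP[fX sX]; rewrite plin_restrict_le.
rewrite plin_dom_restrict ?(eqP fX) ?size_tuple ?eqxx //.
by apply/span_subvP => x /(allP sX).
Qed.

Section Extend.
Variables (c : partial_linear_map N M) (x : V) (v : W).
Hypothesis xc : x \notin plin_dom c.

Lemma line_coef_uniq z (k l : F) : z - k *: x \in plin_dom c ->
  z - l *: x \in plin_dom c -> k = l.
Proof.
move=> zk zl; apply/eqP; rewrite -subr_eq0; apply: contraNT xc => kl.
have := memvB zl zk; rewrite opprB addrC addrA subrK -scalerBl.
by move/(memvZ (k - l)^-1); rewrite scalerA mulVf // scale1r.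
Qed.

(** The extension of [c] by [x |-> v]: on w + k x with [w] in the domain of [c]
    it takes the value c(w) + k v, and [k] is recovered from the vector as
    the only scalar for which subtracting k x leads into the domain. *)
Definition pmap_linext : partial_map V W :=
  [ffun z => if [pick k : F | z - k *: x \in plin_dom c] is Some k
             then omap (+%R^~ (k *: v)) (plin_val c (z - k *: x)) else None].

Lemma pmap_linextP z u :
  reflect (exists k w, plin_val c (z - k *: x) = Some w /\ u = w + k *: v)
          (pmap_linext z == Some u).
Proof.
rewrite ffunE; apply: (iffP eqP) => [|[k [w [ck ->]]]].
  case: pickP => // k _; case E: (plin_val c _) => [w|//] [<-].
  by exists k, w.
have zk : z - k *: x \in plin_dom c by rewrite -isSome_plin ck.
case: pickP => [l zl|/(_ k)]; last by rewrite zk.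
by rewrite -(line_coef_uniq zk zl) ck.
Qed.

Fact pmap_linext_linear : is_plinear pmap_linext.
Proof.
apply/is_plinearP; split.
  have /eqP -> // : pmap_linext 0 == Some 0.
  by apply/pmap_linextP; exists 0, 0; rewrite !scale0r subr0 addr0 plin0.
move=> k y z u w /eqP/pmap_linextP[i [u' [yu ->]]] /eqP/pmap_linextP[j [w' [zw ->]]].
apply/eqP/pmap_linextP; exists (k * i + j), (k *: u' + w'); split.
  rewrite -(plinP k yu zw); congr (plin_val c _).
  by rewrite scalerBr scalerDl scalerA opprD addrACA.
by rewrite scalerDr scalerDl scalerA addrACA.
Qed.

Definition plin_extend := PLinear pmap_linext_linear.

Lemma dom_plin_extend : plin_dom plin_extend = (plin_dom c + <[x]>)%VS.
Proof.
apply/vspaceP => z; rewrite -isSome_plin; apply/idP/memv_addP => [|[w wc [_ /vlineP[k ->] ->]]].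
  case E: (plin_val _ _) => [u|//] _; move/eqP/pmap_linextP: E => [k [w [ck _]]].
  exists (z - k *: x); first by rewrite -isSome_plin ck.
  by exists (k *: x); rewrite ?subrK // memvZ ?memv_line.
move: wc; rewrite -isSome_plin; case E: (plin_val c w) => [u|//] _.
have /eqP -> // : plin_val plin_extend (w + k *: x) == Some (u + k *: v).
by apply/pmap_linextP; exists k, u; rewrite addrK.
Qed.

Lemma dim_plin_extend : \dim (plin_dom plin_extend) = (\dim (plin_dom c)).+1.
Proof.
rewrite dom_plin_extend dimv_disjoint_sum; last first.
  apply/eqP; rewrite -subv0; apply/subvP => y; rewrite memv_cap => /andP[yc].
  case/vlineP=> k yk; rewrite memv0 yk; case: (eqVneq k 0) => [->|k0].
    by rewrite scale0r.
  by case/negP: xc; rewrite -[x](scalerK k0) -yk memvZ.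
rewrite dim_vline (_ : x != 0) ?addn1 //.
by apply: contraNneq xc => ->; rewrite mem0v.
Qed.

Lemma plin_extend_le f :
  plin_le plin_extend f = plin_le c f && (plin_val f x == Some v).
Proof.
apply/pmap_leP/andP => [H|[/pmap_leP H /eqP fx] z].
  split.
    apply/pmap_leP => z; case E: (plin_val c z) => [w|//] _.
    have /eqP Ez : pmap_linext z == Some w.
      by apply/pmap_linextP; exists 0, w; rewrite !scale0r subr0 addr0.
    by rewrite H /= Ez.
  have /eqP Ex : pmap_linext x == Some v.
    by apply/pmap_linextP; exists 1, 0; rewrite !scale1r subrr plin0 add0r.
  by rewrite H /= Ex.
case E: (plin_val plin_extend z) => [u|//] _; move/eqP/pmap_linextP: E => [k [w [ck ->]]].
have fk : plin_val f (z - k *: x) = Some w by rewrite H ck.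
by have := plinP k fx fk; rewrite addrC subrK => ->; rewrite addrC.
Qed.
End Extend.
End Spaces.

(** * Designs and their intersection numbers *)

Section Semilattice.
Variable K : numFieldType.
Implicit Type H : hamming_data.

Lemma hq_gt0 H : (0 < hq H)%N.
Proof. by case: H => // F N M /=; apply: ltnW (finNzRing_gt1 F). Qed.

Lemma hcardM_neq0 H : (hcardM H)%:R != 0 :> K.
Proof.
rewrite pnatr_eq0 -lt0n; case: H => //= F N M.
by apply/card_gt0P; exists 0.
Qed.

Lemma height_le H (c : hsemilattice H) : (height c <= hn H)%N.
Proof.
case: H c => /= [N M _|F N M] c; first exact: max_card.
exact: (dimvS (subvf (plin_dom c))).
Qed.

Lemma gbinom_card_below H (a : hsemilattice H) (r : nat) :
  gbinom K (hq H) (height a) r =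
  #|[set c : hsemilattice H | (c <= a)%O & height c == r]|%:R.
Proof.
case: H a => /= [N M _|F N M] a; first by rewrite /gbinom /= -card_pmap_below.
have q_gt1 := finNzRing_gt1 F; set q := #|F|.
apply: (mulIf (qfalling_neq0 K q_gt1 r)).
by rewrite gbinom_qfalling // -!natr_qfalling // -natrM -card_plin_below.
Qed.

(** Here [T] is M, [e v] extends [c] by the value [v] at a point [x] outside the
    domain of [c], and [p y] is the value at [x] of the everywhere defined [y]. *)
Lemma extension_partition H (c : hsemilattice H) : (height c < hn H)%N ->
  exists (T : finType) (e : T -> hsemilattice H) (p : Omega H -> T),
    [/\ #|T| = hcardM H, forall v, height (e v) = (height c).+1
      & forall (y : Omega H) v, (e v <= val y)%O = (c <= val y)%O && (p y == v)].
Proof.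
case: H c => [N M M0|F N M] c /= hc.
  have [x xc] : exists x, x \notin pmap_dom c.
    apply/existsP; rewrite -negb_forall; apply: contraTN hc => /forallP cT.
    by rewrite -leqNgt -cardsT; apply/subset_leq_card/subsetP => x _; apply: cT.
  have /card_gt0P[v0 _] := M0.
  exists M, (pmap_extend c x), (fun y => odflt v0 ((val y : partial_map N M) x)).
  split=> // [v|[y /= hy] v]; first by rewrite dom_extend cardsU1 xc.
  rewrite [LHS]extend_le //; congr (_ && _).
  have : x \in pmap_dom y.
    suff -> : pmap_dom y = setT by rewrite inE.
    by apply/eqP; rewrite eqEcard subsetT cardsT (eqP hy) leqnn.
  by rewrite inE; case: (y x).
have [x xc] : exists x : finvect_type N, x \notin plin_dom c.
  apply/existsP; rewrite -negb_forall; apply: contraTN hc => /forallP cT.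
  have cTv : (fullv <= plin_dom c)%VS by apply/subvP => x _; apply: cT.
  by rewrite -leqNgt; apply: (dimvS cTv).
exists (finvect_type M), (fun v => plin_extend v xc).
exists (fun y => odflt 0 (plin_val (val y) x)).
split=> // [v|[y /= hy] v]; first exact: dim_plin_extend.
rewrite [LHS]plin_extend_le; congr (_ && _).
have : x \in plin_dom y.
  suff -> : plin_dom y = fullv by rewrite memvf.
  by apply/eqP; rewrite eqEdim subvf (eqP hy); apply: leqnn.
by rewrite -isSome_plin; case: (plin_val y x).
Qed.

Variables (H : hamming_data) (t : nat) (lambda : K) (beta : Omega H -> K).
Hypotheses (le_tn : (t <= hn H)%N) (design : is_design t lambda beta).

(** A [t]-design is an [s]-design for all s <= t: splitting the top elements
    above [c] by extensions of [c] multiplies the index by #M at each step down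
    from the height [t]. *)
Lemma design_below (c : hsemilattice H) : (height c <= t)%N ->
  \sum_(y : Omega H | (c <= val y)%O) beta y =
  (hcardM H)%:R ^+ (t - height c) * lambda.
Proof.
move Ed: (t - height c)%N => d; elim: d c Ed => [|d IH] c Ed lect.
  by rewrite mul1r design //; lia.
have [|T [e [p [cardT he ep]]]] := @extension_partition H c; first by lia.
rewrite (partition_big p predT) //=.
under eq_bigr => v _.
  under eq_bigl do rewrite -ep.
  rewrite IH ?he; [over | by lia..].
by rewrite sumr_const cardT exprS -mulrA mulr_natl.
Qed.

Lemma sum_intersection_number (a : hsemilattice H) (F : nat -> K) :
  \sum_(0 <= s < (hn H).+1) F s * intersection_number beta a s =
  \sum_(y : Omega H) F (height (val y `&` a)%O) * beta y.
Proof.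
have hn_lt (y : Omega H) : (height (val y `&` a)%O < (hn H).+1)%N.
  by rewrite ltnS height_le.
rewrite [RHS](partition_big (fun y => Ordinal (hn_lt y)) predT) //=.
rewrite big_mkord; apply: eq_bigr => s _; rewrite mulr_sumr.
by apply: eq_big => [y|y /eqP <-].
Qed.

(** Double counting of the pairs (c, y) with [c] of height [r] below both [a]
    and [y]. *)
Lemma design_mendelsohn (a : hsemilattice H) :
  mendelsohn_equations t lambda a (intersection_number beta a).
Proof.
move=> r lert.
transitivity (\sum_(0 <= s < (hn H).+1)
    gbinom K (hq H) s r * intersection_number beta a s).
  rewrite big_mkord; apply/esym/big_ord_from => [|s ltsr].
    exact: leq_trans lert le_tn.
  by rewrite gbinom_small ?hq_gt0 ?mul0r.
rewrite (sum_intersection_number a (fun s => gbinom K (hq H) s r)).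
under eq_bigr do rewrite gbinom_card_below mulr_natl -sumr_const.
rewrite (exchange_big_dep [in [set c : hsemilattice H | (c <= a)%O & height c == r]]) /=;
  last by move=> y c _; rewrite !inE lexI => /andP[/andP[_ ->] ->].
rewrite gbinom_card_below -mulrA mulr_natl -sumr_const; apply: eq_bigr => c.
rewrite inE => /andP[leca /eqP hc]; rewrite -hc -design_below ?hc //.
by apply: eq_bigl => y; rewrite inE lexI leca hc eqxx !andbT.
Qed.

(** The Mendelsohn equation for r = 0.  Deriving it from that equation saves the
    construction of a least element. *)
Lemma total_design (a : hsemilattice H) : total beta = (hcardM H)%:R ^+ t * lambda.
Proof.
have := design_mendelsohn a (leq0n t).
rewrite (sum_intersection_number a (fun s => gbinom K (hq H) s 0)).
rewrite gbinom0 mul1r subn0 => <-.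
by apply: eq_bigr => y _; rewrite gbinom0 mul1r.
Qed.

End Semilattice.

(** * Equivalence of the two systems *)

Section Inversion.
Variables (K : numFieldType) (H : hamming_data).
Variables (t : nat) (lambda : K) (a : hsemilattice H) (alpha : nat -> K).
Hypothesis le_tn : (t <= hn H)%N.

(** With [y r] the right-hand side of the [r]-th Mendelsohn equation minus its
    terms beyond [t], that system says that the triangular matrix of Gaussian
    binomials maps [alpha] to [y], and Koehler's that the inverse matrix maps [y]
    to [alpha]. *)
Lemma mendelsohn_kohler :
  mendelsohn_equations t lambda a alpha <-> kohler_equations t lambda a alpha.
Proof.
set q := hq H; have q_gt0 : (0 < q)%N := hq_gt0 H.
set m : K := (hcardM H)%:R; have m0 : m != 0 := hcardM_neq0 K H.
pose y r := gbinom K q (height a) r * m ^+ (t - r) * lambda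
            - \sum_(t.+1 <= u < (hn H).+1) gbinom K q u r * alpha u.
have yE r : (r <= t)%N ->
  \sum_(r <= s < t.+1) qsign K q (s - r) * gbinom K q s r * y s =
  gbinom K q (height a) r * m ^+ (t - r) * lambda *
    (\sum_(0 <= j < (t - r).+1) qsign K q j * gbinom K q (height a - r) j * m ^- j)
  - \sum_(t.+1 <= u < (hn H).+1) gbinom K q u r *
      (\sum_(0 <= j < (t - r).+1) qsign K q j * gbinom K q (u - r) j) * alpha u.
  move=> lert; under eq_bigr do rewrite /y mulrBr mulr_sumr.
  rewrite sumrB exchange_big_nat /=; congr (_ - _).
    rewrite big_nat_shift // mulr_sumr; apply: eq_big_nat => j /andP[_ ltj]; rewrite addKn.
    have -> : m ^+ (t - (r + j)) = m ^+ (t - r) * m ^- j.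
      have -> : (t - r)%N = (t - (r + j) + j)%N by lia.
      by rewrite exprD mulfK ?expf_neq0.
    have := gbinom_trinomial K q_gt0 (height a) (leq_addr j r).
    by rewrite addKn => E; ring: E.
  apply: eq_bigr => u _; rewrite big_nat_shift // mulr_sumr mulr_suml.
  apply: eq_bigr => j _; rewrite addKn.
  have := gbinom_trinomial K q_gt0 u (leq_addr j r); rewrite addKn => E.
  by ring: E.
have [invM invK] := gauss_inversion q_gt0 alpha y t.
have sum_split r : (r <= t)%N ->
    \sum_(r <= s < (hn H).+1) gbinom K q s r * alpha s =
    \sum_(r <= s < t.+1) gbinom K q s r * alpha s
    + \sum_(t.+1 <= u < (hn H).+1) gbinom K q u r * alpha u.
  by move=> lert; rewrite (@big_cat_nat _ _ _ t.+1) //; lia.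
split=> E r lert.
  by rewrite invM ?yE // => s lest; rewrite /y -(E s lest) sum_split ?addrK.
rewrite sum_split // invK ?subrK // => s lest.
by rewrite yE // E.
Qed.
End Inversion.

Theorem corollary3 (R : realType) (H : hamming_data) (t : nat)
    (lambda : R[i]) (beta : Omega H -> R[i]) (a : hsemilattice H) :
  (t <= hn H)%N ->
  is_design t lambda beta ->
  [/\ mendelsohn_equations t lambda a (intersection_number beta a),
      kohler_equations t lambda a (intersection_number beta a),
      (forall alpha : nat -> R[i],
         mendelsohn_equations t lambda a alpha <->
         kohler_equations t lambda a alpha),
      (forall r : nat, (r <= t)%N ->
         gbinom _ (hq H) (height a) r * (hcardM H)%:R ^+ (t - r) * lambda =
         gbinom _ (hq H) (height a) r * (hcardM H)%:R ^- r * total beta :> R[i])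
    & (forall r u : nat, (r <= t)%N -> (t < u <= hn H)%N ->
         \sum_(0 <= j < (t - r).+1)
            (-1) ^+ j * (hq H)%:R ^+ 'C(j, 2) * gbinom _ (hq H) (u - r) j =
         - \sum_(t - r + 1 <= j < (u - r).+1)
            (-1) ^+ j * (hq H)%:R ^+ 'C(j, 2) * gbinom _ (hq H) (u - r) j :> R[i])].
Proof.
move=> le_tn design.
have mendelsohn_beta := design_mendelsohn le_tn design a.
split=> //.
- by apply/(mendelsohn_kohler lambda a _ le_tn).
- by move=> alpha; apply: mendelsohn_kohler.
- move=> r lert; rewrite (total_design le_tn design a) mulrA; congr (_ * _).
  rewrite -mulrA; congr (_ * _); rewrite -{2}(subnK lert) exprD mulrCA.
  by rewrite mulVf ?mulr1 // expf_neq0 // hcardM_neq0.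
move=> r u lert /andP[lttu _]; apply/eqP; rewrite -addr_eq0 addn1.
rewrite -big_cat_nat //=; last by lia.
rewrite (sum_qsign_gbinom_eq0 _ (hq_gt0 H) (leqnn (u - r))).
by rewrite subn_eq0 leqNgt (leq_ltn_trans lert lttu).
Qed.
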